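(* Let $n\ge 2$ and let the convex body $K$ be the vector sum of the convex bodies $K_1,\dots,K_n$ in $\mathbb{E}^d$, i.e., $K=K_1+\cdots+K_n$, such that $\mathrm{coin}(K_i)=f_{m_i}(K_i)$ for $i=1,\dots,n$, and let $\Gamma=\max\{\gamma_{m_i}(K_i):1\le i\le n\}$. Then $$\mathrm{coin}(K)\le\inf_{0<\lambda\le\frac12}\frac{\prod_{i=1}^nN_\lambda(K_i)}{1-\lambda}\le\frac{\prod_{i=1}^nN_\Gamma(K_i)}{1-\Gamma}\le\frac{\prod_{i=1}^nm_i}{1-\Gamma}<\prod_{i=1}^n\mathrm{coin}(K_i).$$ Moreover, equality of $\mathrm{coin}(K)$ with these upper bounds does not hold in general.
   Context: A convex body in $\mathbb{E}^d$ ($d$-dimensional Euclidean space) is a compact convex set with nonempty interior. The vector (Minkowski) sum is $K+L=\{k+l:k\in K,l\in L\}$. For a convex body $K$ in $\mathbb{E}^d$ and $m\in\mathbb{N}=\{1,2,\dots\}$, $\gamma_m(K)=\inf\{\lambda>0:K\subseteq\bigcup_{i=1}^m(\lambda K+t_i),\ t_i\in\mathbb{E}^d\}$; $f_m(K)=\frac{m}{1-\gamma_m(K)}$ if $0<\gamma_m(K)\le\frac12$ and $f_m(K)=+\infty$ if $\frac12<\gamma_m(K)\le1$. The covering index is $\mathrm{coin}(K)=\inf\{f_m(K):m\in\mathbb{N}\}$. For $0<\lambda\le1$, $N_\lambda(K)$ is the minimum number of translates of $\lambda K$ needed to cover $K$. *)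

(* Defs.v *)
From HB Require Import structures.
From mathcomp Require Import all_boot all_order all_algebra.
From mathcomp Require Import all_classical all_reals all_analysis.
Set Implicit Arguments.
Unset Strict Implicit.
Unset Printing Implicit Defensive.
Import Order.TTheory GRing.Theory Num.Theory.
Import numFieldNormedType.Exports.
Local Open Scope classical_set_scope.
Local Open Scope ring_scope.

(* E^d is 'rV[R]_d. Only its topology and vector-space structure are used, so
   it does not matter that the library's norm there is the sup norm. *)

Definition convex_body (R : realType) (d : nat) (K : set 'rV[R]_d) : Prop :=
  [/\ compact K, convex_set K & interior K !=set0].

Definition minkowski_sum (R : realType) (d : nat) (K L : set 'rV[R]_d) :
  set 'rV[R]_d := [set k + l | k in K & l in L].

Definition minkowski_bigsum (R : realType) (d n : nat)
    (K : 'I_n -> set 'rV[R]_d) : set 'rV[R]_d :=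
  \big[@minkowski_sum R d/[set 0]]_(i < n) K i.

Definition homothet (R : realType) (d : nat) (lam : R) (K : set 'rV[R]_d)
    (t : 'rV[R]_d) : set 'rV[R]_d := [set lam *: x + t | x in K].

(* The translation vectors need not be distinct. *)
Definition coverable (R : realType) (d : nat) (K : set 'rV[R]_d) (m : nat)
    (lam : R) : Prop :=
  exists t : 'I_m -> 'rV[R]_d, K `<=` \bigcup_i homothet lam K (t i).

Definition gamma (R : realType) (d : nat) (m : nat) (K : set 'rV[R]_d) : R :=
  inf [set lam | 0 < lam /\ coverable K m lam].

(* For a convex body, d > 0 and m > 0, one has 0 < gamma m K <= 1, so the last
   branch is exactly the case 1/2 < gamma m K <= 1. *)
Definition fm (R : realType) (d : nat) (m : nat) (K : set 'rV[R]_d) : \bar R :=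
  if 0 < gamma m K <= 2^-1 then (m%:R / (1 - gamma m K))%:E else +oo%E.

Definition coin (R : realType) (d : nat) (K : set 'rV[R]_d) : \bar R :=
  ereal_inf [set fm m K | m in [set m : nat | (0 < m)%N]].

(* The least m with [coverable K m lam]. The default value 0 is never reached
   for a convex body and lam > 0: by compactness such an m exists. *)
Definition covering_number (R : realType) (d : nat) (lam : R)
    (K : set 'rV[R]_d) : nat :=
  xget 0%N [set m | coverable K m lam /\
                    forall k : nat, coverable K k lam -> (m <= k)%N].

Definition covering_bound (R : realType) (d n : nat)
    (K : 'I_n -> set 'rV[R]_d) (lam : R) : \bar R :=
  ((\prod_(i < n) covering_number lam (K i))%N%:R / (1 - lam))%:E.

Definition inf_covering_bound (R : realType) (d n : nat)
    (K : 'I_n -> set 'rV[R]_d) : \bar R :=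
  ereal_inf [set covering_bound K lam | lam in [set lam | 0 < lam <= 2^-1]].

(* The base value 0 is harmless: gamma is nonnegative. *)
Definition max_gamma (R : realType) (d n : nat)
    (K : 'I_n -> set 'rV[R]_d) (m : 'I_n -> nat) : R :=
  \big[Num.max/0]_(i < n) gamma (m i) (K i).

(* Main.v *)
Require Import Defs.
From HB Require Import structures.
From mathcomp Require Import all_boot all_order all_algebra.
From mathcomp Require Import finmap.
From mathcomp Require Import all_classical all_reals all_analysis.
Set Implicit Arguments.
Unset Strict Implicit.
Unset Printing Implicit Defensive.
Import Order.TTheory GRing.Theory Num.Theory.
Import numFieldNormedType.Exports.
Local Open Scope classical_set_scope.
Local Open Scope ring_scope.

(** The chain of bounds rests on two facts about coverings of a body K.

    Coverings multiply under vector sums: translates of lam K by s_i covering K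
    and translates of lam L by t_j covering L give translates of lam (K + L) by
    s_i + t_j covering K + L ([coverable_minkowski]).  Hence the product of the
    covering numbers N_lam(K_i) is the size of some covering of the sum by
    translates of its lam-th homothet.  As soon as m translates of lam K cover
    K for some lam <= 1/2, m / (1 - lam) bounds the covering index
    ([coin_le]), which is the first inequality.

    The number gamma_m(K) is positive ([gamma_gt0], by the pigeonhole principle
    applied, for m > 0, to m + 1 equally spaced points of a segment in K) and
    the infimum defining it is attained ([coverable_gamma], by compactness of
    the space of candidate coverings).  Positivity, together with the existence of some
    finite covering by half-size copies, makes the covering index finite, so
    that the hypothesis coin(K_i) = f_{m_i}(K_i) forces 0 < gamma_{m_i}(K_i) <=
    1/2 and Gamma is an admissible ratio.  Attainment, with the monotonicity of
    coverability in the ratio (convexity), gives N_Gamma(K_i) <= m_i.  The last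
    inequality is strict because the product of the 1 / (1 - gamma_{m_i}(K_i))
    has, besides the factor 1 / (1 - Gamma), at least one more factor, and all
    factors exceed 1.

    For the failure of equality any body B may be taken as every summand: the
    sum is then n B, which has the same coverings as B.  So N_lam(B) / (1 - lam)
    already bounds the covering index of the sum, while the bound of the theorem
    is N_lam(B)^n / (1 - lam), at least twice as large because a single smaller
    copy never covers B ([covering_number_gt1]).  Thus coin(n B) lies strictly
    below the smallest of the four bounds ([coin_bigsum_const_lt]).  The indices
    m_i required by the statement exist because f_m >= m, so that the infimum
    defining the covering index ranges in effect over finitely many m
    ([coin_attained]). *)

(** * Coverings by homothets and vector sums *)

Section Covering.
Context {R : realType} {d : nat}.
Implicit Types (K L : set 'rV[R]_d) (lam mu : R) (x t : 'rV[R]_d).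

Lemma convex_set_combination K x y (s : R) :
  convex_set K -> K x -> K y -> 0 <= s <= 1 -> K (s *: x + (1 - s) *: y).
Proof.
move=> cK Kx Ky /andP[s0 s1].
by have := cK x y (Itv01 s0 s1); rewrite !inE => /(_ Kx Ky).
Qed.

(** The convex combination (lam / mu) k + (1 - lam / mu) x of points of K lies
    in K, so a translate of lam K fits inside one of mu K; the shift between
    the two is the same for all translates, whence [coverable_le]. *)
Lemma homothet_subset K lam mu x t : convex_set K -> K x -> 0 <= lam <= mu ->
  homothet lam K t `<=` homothet mu K (t - (mu - lam) *: x).
Proof.
move=> cK Kx /andP[lam0 lamu] _ [k Kk <-].
have [mu0|mu0] := eqVneq mu 0.
  have lamE : lam = 0 by apply/eqP; rewrite eq_le lam0 -mu0 lamu.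
  by exists k => //; rewrite mu0 lamE subrr !scale0r subr0.
have mup : 0 < mu by rewrite lt_def mu0 (le_trans lam0).
exists ((lam / mu) *: k + (1 - lam / mu) *: x).
  apply: convex_set_combination => //.
  by rewrite ler_pdivrMr// mul1r lamu andbT divr_ge0// ltW.
rewrite scalerDr !scalerA mulrBr mulr1 (mulrC mu) divfK//.
by rewrite -addrA [X in _ + X]addrC subrK.
Qed.

Lemma coverable_le K m lam mu : convex_set K -> K !=set0 ->
  0 <= lam <= mu -> coverable K m lam -> coverable K m mu.
Proof.
move=> cK [x Kx] lamu [t Kt]; exists (fun i => t i - (mu - lam) *: x).
by move=> y /Kt[i _ /(homothet_subset cK Kx lamu)]; exists i.
Qed.

(** Lets coverings be indexed by products of ordinals or by finite sets of
    centres instead of by an ordinal. *)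
Lemma coverable_fin K lam (I : finType) (t : I -> 'rV[R]_d) :
  K `<=` \bigcup_i homothet lam K (t i) -> coverable K #|I| lam.
Proof.
move=> Kt; exists (t \o enum_val) => x /Kt[i _ xi].
by exists (enum_rank i); rewrite //= enum_rankK.
Qed.

Lemma coverable_gt0 K m lam : K !=set0 -> coverable K m lam -> (0 < m)%N.
Proof. by move=> [x Kx] [t /(_ _ Kx)[i _ _]]; apply: leq_ltn_trans (ltn_ord i). Qed.

Lemma coverable1 K m : (0 < m)%N -> coverable K m 1.
Proof.
move=> m0; exists (fun=> 0) => x Kx; exists (Ordinal m0) => //.
by exists x => //; rewrite scale1r addr0.
Qed.

(** Covering K by lam K + t and substituting this covering into itself; it
    shows that a ratio below 1 for one translate could be shrunk for ever. *)
Lemma coverable_sqr K lam : coverable K 1 lam -> coverable K 1 (lam ^+ 2).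
Proof.
move=> [t Kt]; exists (fun i => lam *: t i + t i) => x /Kt[i _ [y /Kt[j _ [z Kz <-]] <-]].
exists i => //; exists z => //.
by rewrite (ord1 j) (ord1 i) scalerDr scalerA expr2 addrA.
Qed.

Lemma coverable_minkowski K L a b lam : coverable K a lam -> coverable L b lam ->
  coverable (minkowski_sum K L) (a * b) lam.
Proof.
move=> [s Ks] [t Lt].
have := @coverable_fin (minkowski_sum K L) lam ('I_a * 'I_b)%type
  (fun ij => s ij.1 + t ij.2).
rewrite card_prod !card_ord; apply => _
  [k /Ks[i _ [k' Kk' <-]]] [l /Lt[j _ [l' Ll' <-]]] <-.
exists (i, j) => //; exists (k' + l'); first by exists k' => //; exists l'.
by rewrite scalerDr addrACA.
Qed.

Lemma minkowski_bigsumS n (K : 'I_n.+1 -> set 'rV[R]_d) :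
  minkowski_bigsum K =
  minkowski_sum (K ord0) (minkowski_bigsum (fun i => K (lift ord0 i))).
Proof. by rewrite /minkowski_bigsum big_ord_recl. Qed.

Lemma coverable_bigsum n (K : 'I_n -> set 'rV[R]_d) (N : 'I_n -> nat) lam :
  (forall i, coverable (K i) (N i) lam) ->
  coverable (minkowski_bigsum K) (\prod_(i < n) N i) lam.
Proof.
elim: n => [|n IHn] in K N *; move=> KN.
  rewrite /minkowski_bigsum !big_ord0; exists (fun=> 0) => _ ->.
  by exists ord0 => //; exists 0 => //; rewrite scaler0 addr0.
rewrite minkowski_bigsumS big_ord_recl.
by apply: coverable_minkowski => //; exact: IHn.
Qed.

(** * Vector sums of bodies *)

Lemma compact_minkowski K L : compact K -> compact L -> compact (minkowski_sum K L).
Proof.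
move=> cK cL; rewrite (_ : minkowski_sum K L = (fun p => p.1 + p.2) @` (K `*` L)).
  apply: continuous_compact; last exact: compact_setX.
  by apply: continuous_subspaceT; exact: add_continuous.
apply/seteqP; split=> [_ [k Kk] [l Ll] <-|_ [[k l] /= [Kk Ll] <-]].
  by exists (k, l).
by exists k => //; exists l.
Qed.

Lemma interior_minkowski K L : interior K !=set0 -> L !=set0 ->
  interior (minkowski_sum K L) !=set0.
Proof.
move=> [x /nbhs_ballP[r /= r0 xrK]] [l Ll]; exists (x + l).
apply/nbhs_ballP; exists r => // y; rewrite -ball_normE /= => xy.
exists (y - l); last by exists l => //; rewrite subrK.
apply: xrK; rewrite -ball_normE /=.
by rewrite opprB addrA.
Qed.

(** Compactness and an interior point are what [coin_le] asks of the sum. *)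
Lemma minkowski_bigsum_body n (K : 'I_n -> set 'rV[R]_d) : (0 < n)%N ->
  (forall i, compact (K i) /\ interior (K i) !=set0) ->
  compact (minkowski_bigsum K) /\ interior (minkowski_bigsum K) !=set0.
Proof.
move=> n0 KP.
have {KP}[cK iK] : (forall i, compact (K i)) /\ (forall i, interior (K i) !=set0).
  by split=> i; case: (KP i).
(* The interior comes from the first summand alone; the induction therefore
   carries only nonemptiness, which also holds for the empty sum. *)
have sum0 : forall j (L : 'I_j -> set 'rV[R]_d), (forall i, compact (L i)) ->
    (forall i, interior (L i) !=set0) ->
    compact (minkowski_bigsum L) /\ minkowski_bigsum L !=set0.
  elim=> [|j IHj] L cL iL.
    by rewrite /minkowski_bigsum big_ord0; split; [exact: compact_set1|exists 0].
  have [c' [y Ly]] := IHj _ (fun i => cL (lift ord0 i)) (fun i => iL (lift ord0 i)).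
  rewrite minkowski_bigsumS; split; first exact: compact_minkowski.
  have [x Lx] := iL ord0; exists (x + y), x; first exact: interior_subset.
  by exists y.
split; first exact: (sum0 _ K cK iK).1.
case: n n0 => // n _ in K cK iK *; rewrite minkowski_bigsumS.
apply: interior_minkowski => //.
exact: (sum0 _ _ (fun i => cK (lift ord0 i)) (fun i => iK (lift ord0 i))).2.
Qed.

(** * Existence of finite coverings *)

(** A ball of radius r in K around x gives balls of radius lam r in the
    translates of lam K; those centred at points of K form an open cover. *)
Lemma coverable_exists K lam : compact K -> interior K !=set0 -> 0 < lam ->
  exists m, coverable K m lam.
Proof.
move=> cK [x /nbhs_ballP[r /= r0 xrK]] lam0.
have := cK; rewrite compact_cover => /(_ _ K (fun s => ball s (lam * r))).
case=> [s _|s Ks|D _ KD].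
- exact: ball_open.
- by exists s => //; apply: ballxx; rewrite mulr_gt0.
suff /coverable_fin : K `<=` \bigcup_(s : D) homothet lam K (val s - lam *: x).
  by exists #|{: D}|.
move=> y /KD[s /= sD].
rewrite -ball_normE /= => sy; exists [` sD]%fset => //=.
exists (x + lam^-1 *: (y - s)); last first.
  by rewrite scalerDr scalerA mulfV ?gt_eqF// scale1r
    [X in X + _]addrC addrACA subrK subrr addr0.
apply: xrK; rewrite -ball_normE /= opprD addrA subrr sub0r normrN normrZ.
by rewrite gtr0_norm ?invr_gt0// mulrC ltr_pdivrMr// distrC mulrC.
Qed.

Lemma covering_numberP K lam : compact K -> interior K !=set0 -> 0 < lam ->
  coverable K (covering_number lam K) lam /\
  forall k, coverable K k lam -> (covering_number lam K <= k)%N.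
Proof.
move=> cK iK lam0; apply: (xgetPex 0%N (P := [set m | coverable K m lam /\
  forall k : nat, coverable K k lam -> (m <= k)%N])).
have exK : exists m, `[< coverable K m lam >].
  by have [m Km] := coverable_exists cK iK lam0; exists m; apply/asboolP.
case: (ex_minnP exK) => m /asboolP Km minm.
by exists m; split=> // k /asboolP/minm.
Qed.

(** * The optimal ratio gamma: positive and attained *)

(** Among m + 1 equally spaced points of a segment inside K, two fall into the
    same translate of lam K, whose diameter is at most lam times that of K. A
    nonzero direction for the segment exists because d > 0. *)
Lemma coverable_ratio_lower_bound K m : (0 < d)%N -> compact K -> interior K !=set0 ->
  exists2 e : R, 0 < e & forall lam, 0 < lam -> coverable K m lam -> e <= lam.
Proof.
move=> d0 cK [x /nbhs_ballP[r /= r0 xrK]].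
have /ex_strict_bound_gt0[M /= M0 KM] : bounded_set K by exact: compact_bounded.
pose u : 'rV[R]_d := const_mx 1.
have u0 : 0 < `|u|.
  rewrite normr_gt0; apply/eqP => /rowP/(_ (Ordinal d0)).
  by rewrite !mxE => /eqP; rewrite oner_eq0.
(* The step e keeps the m + 1 points x, x + e u, ..., x + m e u within distance
   r of x. *)
pose e := r / (m.+1%:R * `|u|).
have e0 : 0 < e by rewrite divr_gt0// mulr_gt0// ltr0n.
pose p (i : 'I_m.+1) := x + (i%:R * e) *: u.
have Kp i : K (p i).
  apply: xrK; rewrite -ball_normE /= opprD addrA subrr sub0r normrN normrZ.
  rewrite ger0_norm; last by rewrite mulr_ge0// ltW.
  rewrite -mulrA (_ : e * `|u| = r / m.+1%:R); last first.
    by rewrite /e invfM mulrA divfK// gt_eqF.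
  by rewrite mulrCA gtr_pMr// ltr_pdivrMr ?ltr0n// mul1r ltr_nat.
exists (e * `|u| / (2 * M)); first by rewrite divr_gt0// mulr_gt0.
move=> lam lam0 [t Kt].
have /choice[f fP] : forall i, exists j, homothet lam K (t j) (p i).
  by move=> i; have [j _ pj] := Kt _ (Kp i); exists j.
have [i [j [ij fij]]] : exists i j, i != j /\ f i = f j.
  apply: contrapT => nf; suff /leq_card : injective f by rewrite !card_ord ltnn.
  by move=> i j fij; apply: contrapT => /eqP ij; apply: nf; exists i, j.
rewrite ler_pdivrMr ?mulr_gt0//.
have [k Kk pk] := fP i; have [l Kl pl] := fP j.
apply: (@le_trans _ _ `|p i - p j|).
  rewrite /p opprD addrACA subrr add0r -scalerBl normrZ -mulrBl normrM.
  rewrite (gtr0_norm e0) ler_pM2r//; apply: ler_peMl; first exact: ltW.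
  wlog ltij : i j ij {fij k Kk pk l Kl pl} / (i < j)%N => [wl|].
    have [ltij|ltji|/val_inj/eqP] := ltngtP i j; last by rewrite (negbTE ij).
      exact: wl.
    by rewrite distrC wl// eq_sym.
  by rewrite distrC -natrB 1?ltnW// normr_nat ler1n subn_gt0.
rewrite -pk -pl fij opprD addrACA subrr addr0 -scalerBr normrZ gtr0_norm//.
rewrite ler_pM2l// (le_trans (ler_normB _ _))// mulr_natl mulr2n.
by apply: lerD; apply/ltW/KM.
Qed.

Lemma gamma_gt0 K m : (0 < d)%N -> (0 < m)%N -> compact K -> interior K !=set0 ->
  0 < gamma m K.
Proof.
move=> d0 m0 cK iK; have [e e0 eP] := @coverable_ratio_lower_bound K m d0 cK iK.
apply: (lt_le_trans e0); apply: lb_le_inf.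
  by exists 1; split => //; exact: coverable1.
by move=> lam [lam0 Klam]; exact: eP.
Qed.

Lemma gamma_le K m lam : 0 < lam -> coverable K m lam -> gamma m K <= lam.
Proof.
by move=> lam0 Klam; apply: ge_inf => //; exists 0 => mu [/ltW].
Qed.

(** The pairs (lam, t) with x in lam K + t are the projection, along the compact
    set K, of the closed set of (k, lam, t) with lam k + t = x. *)
Lemma closed_mem_homothet K x : compact K ->
  closed [set p : R * 'rV[R]_d | homothet p.1 K p.2 x].
Proof.
move=> /compact_near_coveringP cK.
rewrite -[X in closed X]setCK; apply: open_closedC; rewrite openE => p /= xp.
suff H : \forall q \near p, K `<=` (fun k => q.1 *: k + q.2 <> x).
  by apply: filterS H => q qx [k /qx].
apply: (cK _ (nbhs p) (fun q k => q.1 *: k + q.2 <> x)) => k Kk.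
have kx : p.1 *: k + p.2 <> x by move=> kx; apply: xp; exists k.
have cf : (fun z : 'rV[R]_d * (R * 'rV[R]_d) => z.2.1 *: z.1 + z.2.2) z @[z --> (k, p)]
    --> p.1 *: k + p.2.
  apply: cvgD; first apply: cvgZ.
  - by apply: (@cvg_comp _ _ _ snd fst); [exact: cvg_snd|exact: cvg_fst].
  - exact: cvg_fst.
  - by apply: (@cvg_comp _ _ _ snd snd); [exact: cvg_snd|exact: cvg_snd].
apply: (cf (~` [set x])).
apply: open_nbhs_nbhs; split=> //.
apply: closed_openC; apply: accessible_closed_set1.
by apply: hausdorff_accessible; exact: norm_hausdorff.
Qed.


(** The pairs of a ratio in [0, 1] and an m-tuple of translations that cover K
    form a compact set, on which the ratio takes its minimum. Ratio 0 is
    included to have a compact interval; the minimum lies below gamma, and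
    monotonicity in the ratio transfers the covering to gamma itself. *)
Lemma coverable_gamma K m : (0 < m)%N -> compact K -> convex_set K -> K !=set0 ->
  coverable K m (gamma m K).
Proof.
move=> m0 cK convK [x0 Kx0].
(* A translate of lam K meets K only if its translation vector is x - lam k for
   some x and k in K; B collects these vectors. *)
pose B := (fun p : 'rV[R]_d * (R * 'rV[R]_d) => p.1 - p.2.1 *: p.2.2) @`
  (K `*` (`[0, 1] `*` K)).
have cB : compact B.
  apply: continuous_compact; last first.
    by apply: compact_setX => //; apply: compact_setX => //; exact: segment_compact.
  apply: continuous_subspaceT => p; apply: cvgB; first exact: cvg_fst.
  apply: cvgZ.
    by apply: (@cvg_comp _ _ _ snd fst); [exact: cvg_snd|exact: cvg_fst].
  by apply: (@cvg_comp _ _ _ snd snd); [exact: cvg_snd|exact: cvg_snd].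
pose T := prod_topology (fun _ : 'I_m => 'rV[R]_d).
pose C : set (R * T) := \bigcap_(x in K) \bigcup_(i in [set: 'I_m])
  [set p : R * T | homothet p.1 K (p.2 i) x].
have clC : closed C.
  apply: closed_bigI => x Kx; apply: closed_bigcup; first exact: finite_finset.
  move=> i _.
  have := @closed_mem_homothet K x cK.
  apply: (@preimage_closed _ _ (fun p : R * T => (p.1, p.2 i))) => p _.
  apply: (@cvg_pair _ _ _ (nbhs p) (nbhs p.1) (nbhs (p.2 i))); first exact: cvg_fst.
  apply: (@cvg_comp _ _ _ snd (fun v : T => v i)); first exact: cvg_snd.
  exact: (@proj_continuous _ (fun _ : 'I_m => 'rV[R]_d) i p.2).
pose A : set (R * T) := (`[0, 1] `*` [set v : T | forall i, B (v i)]) `&` C.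
have cA : compact A.
  apply: compact_closedI => //; apply: compact_setX; first exact: segment_compact.
  by apply: (@tychonoff _ (fun _ : 'I_m => 'rV[R]_d) (fun=> B)) => i.
have Acov lam : 0 <= lam <= 1 -> coverable K m lam -> exists v : T, A (lam, v).
  move=> lam01 [t Kt].
  (* A translate whose vector is outside B misses K and may be moved at will. *)
  pose v i := if `[< B (t i) >] then t i else x0 - lam *: x0.
  exists v; split => [|x Kx].
    split; first by rewrite /= in_itv.
    move=> i; rewrite /= /v; case: ifPn => [/asboolP//|_].
    by exists (x0, (lam, x0)) => //; split => //; split; rewrite //= in_itv.
  have [i _ [k Kk kx]] := Kt _ Kx.
  exists i => //=; exists k => //; rewrite /v asboolT//.
  exists (x, (lam, k)); first by split => //; split; rewrite //= in_itv.
  by rewrite /= -kx addrAC subrr add0r.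
have [v1 Av1] := Acov 1 (introT andP (conj ler01 (lexx _))) (coverable1 K m0).
have [[lam v]] := @compact_EVT_min _ R fst A (ex_intro _ _ Av1) cA
  (continuous_subspaceT (fun p => cvg_fst)).
rewrite inE => -[[/= lam01 _] Cv] minlam.
have lamle mu : 0 < mu -> coverable K m mu -> lam <= mu.
  move=> mu0 Kmu; have [mu1|/ltW mu1] := leP mu 1.
    have [|w Aw] := Acov mu _ Kmu; first by rewrite mu1 ltW.
    by apply: (minlam (mu, w)); rewrite inE.
  by move: lam01; rewrite in_itv => /= /andP[_ /le_trans]; apply.
apply: (@coverable_le K m lam) => //; first by exists x0.
  apply/andP; split; first by move: lam01; rewrite in_itv => /= /andP[].
  apply: lb_le_inf; first by exists 1; split => //; exact: coverable1.
  by move=> mu [mu0]; exact: lamle.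
by exists v => x /Cv.
Qed.

End Covering.

(** * The covering index *)

Section CoveringIndex.
Context {R : realType} {d : nat} (hd : (0 < d)%N).
Implicit Types (K : set 'rV[R]_d) (lam : R).

(** Positivity of gamma_m(K) matters here: a vanishing gamma_m(K) would put
    f_m(K) at infinity. *)
Lemma coin_le K m lam : compact K -> interior K !=set0 -> 0 < lam <= 2^-1 ->
  coverable K m lam -> (coin K <= (m%:R / (1 - lam))%:E)%E.
Proof.
move=> cK iK /andP[lam0 lam2] Klam.
have lam1 : lam < 1 by rewrite (le_lt_trans lam2)// invf_lt1// ltr1n.
have m0 : (0 < m)%N.
  by apply: coverable_gt0 Klam; apply: subset_nonempty iK; exact: interior_subset.
have glam := gamma_le lam0 Klam.
apply: (@le_trans _ _ (fm m K)); first by apply: ereal_inf_lbound; exists m.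
rewrite /fm gamma_gt0//= (le_trans glam lam2) lee_fin ler_wpM2l//.
by rewrite lef_pV2 ?posrE ?subr_gt0 ?lerD2l ?lerN2// (le_lt_trans glam).
Qed.

Lemma fm_ge K m : (m%:R%:E <= fm m K)%E.
Proof.
rewrite /fm; case: ifPn => [/andP[g0 g2]|_]; last exact: leey.
have g1 : gamma m K < 1 by rewrite (le_lt_trans g2)// invf_lt1// ltr1n.
by rewrite lee_fin ler_pdivlMr ?subr_gt0// ler_piMr// lerBlDr lerDl ltW.
Qed.

Lemma coin_ge1 K : (1 <= coin K)%E.
Proof.
apply: le_ereal_inf_tmp => _ [m /= m0 <-]; apply: le_trans (fm_ge K m).
by rewrite lee_fin ler1n.
Qed.

Lemma coin_fin_num K : compact K -> interior K !=set0 -> coin K \is a fin_num.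
Proof.
move=> cK iK; rewrite ge0_fin_numE; last by rewrite (le_trans _ (coin_ge1 K)).
have h2 : (0 : R) < 2^-1 by rewrite invr_gt0.
have [m Km] := coverable_exists cK iK h2.
by apply: (le_lt_trans (coin_le cK iK _ Km)); rewrite ?h2/= ?ltry.
Qed.

(** The covering index is finite, so an index m attaining it cannot be in the
    branch where f_m is infinite. *)
Lemma fm_coinE K m : compact K -> interior K !=set0 -> coin K = fm m K ->
  0 < gamma m K <= 2^-1 /\ coin K = (m%:R / (1 - gamma m K))%:E.
Proof.
move=> cK iK; have := coin_fin_num cK iK; rewrite /fm.
by case: ifPn => // _ + coinE; rewrite coinE.
Qed.

(** Since f_m >= m, the indices beyond some f_{m0} < +oo cannot improve on m0,
    and a minimum over the remaining finitely many exists. *)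
Lemma coin_attained K : compact K -> interior K !=set0 ->
  exists2 m, (0 < m)%N & coin K = fm m K.
Proof.
move=> cK iK.
have h2 : (0 : R) < 2^-1 by rewrite invr_gt0.
have [m0 Km0] := coverable_exists cK iK h2.
have m0gt0 : (0 < m0)%N.
  by apply: coverable_gt0 Km0; apply: subset_nonempty iK; exact: interior_subset.
have g0 := gamma_gt0 hd m0gt0 cK iK.
have fm0 : (fm m0 K < +oo)%E by rewrite /fm g0 (gamma_le h2 Km0) ltry.
have [M fM] : exists M, (fm m0 K <= M%:R%:E)%E.
  move: fm0; rewrite /fm; case: ifPn => // _ _.
  by eexists; rewrite lee_fin; apply/ltW/truncnS_gt.
have m0M : (m0 < M.+1)%N by rewrite ltnS -(ler_nat R) -lee_fin (le_trans (fm_ge K m0)).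
case: (@arg_minP _ _ _ (Ordinal m0M) (fun i => 0 < i)%N (fun i => fm i K)) => // i i0 mini.
exists i => //; apply/eqP; rewrite eq_le ereal_inf_lbound ?andTb; last by exists i.
apply: le_ereal_inf_tmp => _ [m /= mgt0 <-].
have [mM|Mm] := ltnP m M.+1; first exact: (mini (Ordinal mM)).
apply: (le_trans (mini (Ordinal m0M) m0gt0)); apply: (le_trans fM).
by apply: le_trans (fm_ge K m); rewrite lee_fin ler_nat ltnW.
Qed.

(** If one translate of lam K covered K, then gamma_1(K) < 1 would be attained,
    and iterating that covering would give the ratio gamma_1(K)^2, which is
    smaller since gamma_1(K) > 0. *)
Lemma covering_number_gt1 K lam : convex_body K -> 0 < lam < 1 ->
  (1 < covering_number lam K)%N.
Proof.
move=> [cK convK iK] /andP[lam0 lam1].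
have K0 : K !=set0 by apply: subset_nonempty iK; exact: interior_subset.
have [KN _] := covering_numberP cK iK lam0.
rewrite ltnNge; apply/negP => N1.
have N0 := coverable_gt0 K0 KN.
have {N0 N1} NE : covering_number lam K = 1%N by apply/eqP; rewrite eqn_leq N1 N0.
rewrite NE in KN; have g0 := gamma_gt0 hd (ltn0Sn 0) cK iK.
have := gamma_le (exprn_gt0 2 g0)
  (coverable_sqr (coverable_gamma (ltn0Sn 0) cK convK K0)).
rewrite leNgt expr2 gtr_pMr// (le_lt_trans (gamma_le lam0 KN))//.
Qed.

Lemma coverable_homothet K m lam c :
  coverable K m lam -> coverable (homothet c K 0) m lam.
Proof.
move=> [t Kt]; exists (fun i => c *: t i) => _ [x /Kt[i _ [k Kk <-]] <-].
exists i => //; exists (c *: k); first by exists k => //; rewrite addr0.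
by rewrite addr0 scalerDr !scalerA mulrC.
Qed.

(** By convexity k + n l is n + 1 times the point (k + n l) / (n + 1) of K. *)
Lemma minkowski_bigsum_const K n : convex_set K -> K !=set0 ->
  minkowski_bigsum (fun _ : 'I_n => K) = homothet n%:R K 0.
Proof.
move=> convK [x0 Kx0]; elim: n => [|n IHn].
  rewrite /minkowski_bigsum big_ord0; apply/seteqP; split => [_ ->|_ [k _ <-]].
    by exists x0 => //; rewrite scale0r addr0.
  by rewrite scale0r addr0.
rewrite minkowski_bigsumS IHn.
have n1 : (n.+1%:R : R) != 0 by rewrite pnatr_eq0.
apply/seteqP; split => [_ [k Kk] [_ [l Kl <-] <-]|_ [k Kk <-]]; last first.
  exists k => //; exists (n%:R *: k); first by exists k => //; rewrite addr0.
  by rewrite addr0 -{1}[k]scale1r -scalerDl -natr1 addrC.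
exists (n.+1%:R^-1 *: k + (1 - n.+1%:R^-1) *: l).
  apply: convex_set_combination => //.
  by rewrite invr_ge0 ler0n/= invf_le1 ?ltr0n// ler1n.
rewrite !addr0 scalerDr !scalerA mulrBr mulfV// mulr1 scale1r.
by rewrite -natr1 addrK.
Qed.

Lemma unit_ball_convex_body : convex_body [set x : 'rV[R]_d | `|x| <= 1].
Proof.
split.
- apply: bounded_closed_compact.
    by exists 1; split => // M M1 x /= /le_trans; apply; exact: ltW.
  have := @closed_ball_closed _ 'rV[R]_d 0 1; rewrite closed_ballE//.
  by congr closed; apply/seteqP; split => x /=; rewrite /closed_ball_ /= sub0r normrN.
- move=> x y l; rewrite !inE /= => x1 y1.
  rewrite (le_trans (ler_normD _ _))// !normrZ.
  have [l0 l1] : 0 <= l%:num /\ 0 <= 1 - l%:num by rewrite subr_ge0.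
  rewrite (ger0_norm l0) (ger0_norm l1).
  by rewrite -[leRHS](subrKC l%:num) lerD// ler_piMr.
- exists 0; apply/nbhs_ballP; exists 1 => //= x; rewrite -ball_normE /= sub0r normrN.
  exact: ltW.
Qed.

End CoveringIndex.

(** * The chain of bounds and its strictness *)

(** The maximum is the value at some j; the factor at j equals the left-hand
    side, and the factor at any other index k, which exists as n >= 2, is
    greater than 1. *)
Lemma ltr_bigmax_prodV (R : realType) (n : nat) (g : 'I_n -> R) : (2 <= n)%N ->
  (forall i, 0 < g i < 1) ->
  (1 - \big[Num.max/0]_(i < n) g i)^-1 < \prod_(i < n) (1 - g i)^-1.
Proof.
move=> n2 g01.
have V1 i : 1 < (1 - g i)^-1.
  have /andP[g0 g1] := g01 i.
  by rewrite invf_gt1 ?subr_gt0// ltrBlDr ltrDl.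
pose i0 : 'I_n := Ordinal (ltnW n2).
have [||j _ ->] := @eq_bigmax _ _ _ (0 : R) i0 predT g => //.
  by move=> i _; have /andP[/ltW] := g01 i.
have [k kj] : exists k : 'I_n, k != j.
  have [ji0|] := eqVneq i0 j; last by exists i0.
  by exists (Ordinal n2); rewrite -ji0.
rewrite (bigD1 j)//= ltr_pMr; last by rewrite (lt_trans ltr01).
rewrite (bigD1 k)//= (lt_le_trans (V1 k))// ler_peMr//.
  by rewrite (le_trans ler01)// ltW.
elim/big_ind: _ => // [x y x1 y1|i _]; last exact: ltW.
by rewrite mulr_ege1.
Qed.

Lemma coin_bigsum_le (R : realType) (d n : nat) (K : 'I_n -> set 'rV[R]_d) :
  (0 < d)%N -> (0 < n)%N -> (forall i, convex_body (K i)) ->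
  (coin (minkowski_bigsum K) <= inf_covering_bound K)%E.
Proof.
move=> hd n0 KP.
have cK i : compact (K i) by case: (KP i).
have iK i : interior (K i) !=set0 by case: (KP i).
have [cS iS] := minkowski_bigsum_body n0 (fun i => conj (cK i) (iK i)).
apply: le_ereal_inf_tmp => _ [lam /= lamP <-]; apply: coin_le => //.
apply: coverable_bigsum => i; apply: (covering_numberP _ _ _).1 => //.
by have /andP[] := lamP.
Qed.

Lemma covering_bounds (R : realType) (d n : nat) (hd : (0 < d)%N) (hn : (2 <= n)%N)
    (K : 'I_n -> set 'rV[R]_d) (m : 'I_n -> nat) :
  (forall i, convex_body (K i)) -> (forall i, (0 < m i)%N) ->
  (forall i, coin (K i) = fm (m i) (K i)) ->
  let Gam := max_gamma K m in
  [/\ (inf_covering_bound K <= covering_bound K Gam)%E,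
      (covering_bound K Gam <= ((\prod_(i < n) m i)%N%:R / (1 - Gam))%:E)%E &
      (((\prod_(i < n) m i)%N%:R / (1 - Gam))%:E < \prod_(i < n) coin (K i))%E].
Proof.
move=> KP m0 coinK Gam.
have cK i : compact (K i) by case: (KP i).
have convK i : convex_set (K i) by case: (KP i).
have iK i : interior (K i) !=set0 by case: (KP i).
have g2 i : 0 < gamma (m i) (K i) <= 2^-1.
  exact: (fm_coinE hd (cK i) (iK i) (coinK i)).1.
have h21 : (2^-1 : R) < 1 by rewrite invf_lt1// ltr1n.
have gGam i : gamma (m i) (K i) <= Gam.
  by exact: (le_bigmax _ (fun i => gamma (m i) (K i))).
have Gam2 : 0 < Gam <= 2^-1.
  apply/andP; split.
    by apply: lt_le_trans (gGam (Ordinal (ltnW hn))); case/andP: (g2 (Ordinal (ltnW hn))).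
  by apply/bigmax_leP; split => [|i _]; rewrite ?invr_ge0//; case/andP: (g2 i).
have /andP[Gam0 Gam2'] := Gam2.
have Gam1 : 0 < 1 - Gam by rewrite subr_gt0 (le_lt_trans Gam2').
split.
- by apply: ereal_inf_lbound; exists Gam.
- rewrite lee_fin ler_pM2r ?invr_gt0// ler_nat; apply: leq_prod => i _.
  apply: (covering_numberP (cK i) (iK i) Gam0).2.
  have K0 : K i !=set0 by apply: subset_nonempty (iK i); exact: interior_subset.
  apply: (coverable_le (convK i) K0 _ (coverable_gamma (m0 i) (cK i) (convK i) K0)).
  by rewrite gGam andbT; case/andP: (g2 i) => /ltW.
- rewrite (eq_bigr _ (fun i _ => (fm_coinE hd (cK i) (iK i) (coinK i)).2)).
  rewrite prodEFin lte_fin.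
  rewrite big_split/= natr_prod ltr_pM2l; last by apply: prodr_gt0 => i _; rewrite ltr0n.
  apply: ltr_bigmax_prodV => // i; case/andP: (g2 i) => -> /=.
  by move=> /le_lt_trans; apply.
Qed.

(** The sum is n K, so coin(n K) <= N / (1 - lam) for N = N_lam(K), whereas the
    bound at lam is N^n / (1 - lam) with N >= 2 and n >= 2. Comparing with
    2 coin(n K) keeps the inequality strict when passing to the infimum over
    lam. *)
Lemma coin_bigsum_const_lt (R : realType) (d n : nat) (K : set 'rV[R]_d) :
  (0 < d)%N -> (2 <= n)%N -> convex_body K ->
  (coin (minkowski_bigsum (fun _ : 'I_n => K)) <
   inf_covering_bound (fun _ : 'I_n => K))%E.
Proof.
move=> hd hn KP; have [cK convK iK] := KP.
have K0 : K !=set0 by apply: subset_nonempty iK; exact: interior_subset.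
have n0 : (0 < n)%N by exact: ltnW.
have [cS iS] := minkowski_bigsum_body n0 (fun _ : 'I_n => conj cK iK).
have coinfin := coin_fin_num hd cS iS.
set S := minkowski_bigsum _ in cS iS coinfin *.
have coin1 := coin_ge1 S.
have c1 : 1 <= fine (coin S) by rewrite -lee_fin fineK.
apply: (@lt_le_trans _ _ (2 * fine (coin S))%:E).
  by rewrite -{1}(fineK coinfin) lte_fin ltr_pMl ?ltr1n// (lt_le_trans ltr01).
apply: le_ereal_inf_tmp => _ [lam /= lamP <-].
have /andP[lam0 lam2] := lamP.
have lam1 : lam < 1 by rewrite (le_lt_trans lam2)// invf_lt1// ltr1n.
have [KN _] := covering_numberP cK iK lam0.
have N1 := covering_number_gt1 hd KP (introT andP (conj lam0 lam1)).
rewrite /covering_bound prod_nat_const card_ord.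
set N := covering_number lam K in KN N1 *.
have : (coin S <= (N%:R / (1 - lam))%:E)%E.
  apply: coin_le => //; rewrite /S minkowski_bigsum_const//.
  exact: coverable_homothet.
rewrite -{1}(fineK coinfin) !lee_fin => coinN.
apply: (@le_trans _ _ (2 * (N%:R / (1 - lam)))); first by rewrite ler_pM2l.
rewrite mulrA ler_pM2r ?invr_gt0 ?subr_gt0// -natrM ler_nat.
case: n hn {n0 S cS iS coinfin coin1 c1 coinN} => [|[|n]]// _.
by rewrite mulnC expnS leq_mul// expnS (leq_trans N1)// leq_pmulr// expn_gt0 ltnW.
Qed.

Theorem theorem4p6 (R : realType) (d n : nat) (hd : (0 < d)%N) (hn : (2 <= n)%N) :
  (forall (K : 'I_n -> set 'rV[R]_d) (m : 'I_n -> nat),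
     (forall i, convex_body (K i)) ->
     (forall i, (0 < m i)%N) ->
     (forall i, coin (K i) = fm (m i) (K i)) ->
     let Gam := max_gamma K m in
     [/\ (coin (minkowski_bigsum K) <= inf_covering_bound K)%E,
         (inf_covering_bound K <= covering_bound K Gam)%E,
         (covering_bound K Gam <= ((\prod_(i < n) m i)%N%:R / (1 - Gam))%:E)%E &
         (((\prod_(i < n) m i)%N%:R / (1 - Gam))%:E < \prod_(i < n) coin (K i))%E])
  /\
  (exists (K : 'I_n -> set 'rV[R]_d) (m : 'I_n -> nat),
     let Gam := max_gamma K m in
     [/\ (forall i, convex_body (K i)),
         (forall i, (0 < m i)%N) &
         (forall i, coin (K i) = fm (m i) (K i))] /\
     [/\ coin (minkowski_bigsum K) <> inf_covering_bound K,
         coin (minkowski_bigsum K) <> covering_bound K Gam,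
         coin (minkowski_bigsum K) <> ((\prod_(i < n) m i)%N%:R / (1 - Gam))%:E &
         coin (minkowski_bigsum K) <> (\prod_(i < n) coin (K i))%E]).

Proof.
split=> [K m KP m0 coinK Gam|].
  have [le1 le2 lt3] := covering_bounds hd hn KP m0 coinK.
  by split=> //; apply: coin_bigsum_le => //; exact: ltnW.
pose B := [set x : 'rV[R]_d | `|x| <= 1].
have BP : convex_body B := unit_ball_convex_body.
have [cB _ iB] := BP.
have [m m0 coinB] := coin_attained hd cB iB.
exists (fun=> B), (fun=> m) => Gam; split => //.
have [le1 le2 lt3] := covering_bounds hd hn (fun _ : 'I_n => BP) (fun=> m0) (fun=> coinB).
have lt0 := coin_bigsum_const_lt hd hn BP.
have lt1 := lt_le_trans lt0 le1.
have lt2 := lt_le_trans lt1 le2.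
by split; apply/eqP; rewrite lt_eqF//; exact: lt_trans lt3.
Qed.
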